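(* Let $0<\rho<1$ be a constant and let $\sigma\in\Sigma$ be such that for all sufficiently large $n$ and all $1\le k\le n-1$ we have $\sigma(k,n-k)\le\rho$. Then \[ \mathcal{D}_\sigma(n)\in\Omega\left(\frac{n}{\log n}\right). \]
   Context: Binary trees are terms over a leaf symbol $a$ and a binary symbol $f$: $a$ is a binary tree, and if $t_1,t_2$ are binary trees then so is $f(t_1,t_2)$. $|t|$ is the number of leaves of $t$, $\mathcal{T}_n$ the set of binary trees with $n$ leaves. $|\mathcal{D}_t|$ (the size of the minimal DAG of $t$) is the number of pairwise non-isomorphic subtrees of $t$. $\Sigma$ is the set of functions $\sigma:(\mathbb{N}\setminus\{0\})^2\to[0,1]$ with $\sum_{i,j\ge1,\, i+j=k}\sigma(i,j)=1$ for every integer $k\ge2$. For $\sigma\in\Sigma$, $P_\sigma(a)=1$ and $P_\sigma(f(u,v))=\sigma(|u|,|v|)P_\sigma(u)P_\sigma(v)$, and $\mathcal{D}_\sigma(n)=\sum_{t\in\mathcal{T}_n}P_\sigma(t)|\mathcal{D}_t|$. $\log$ is the binary logarithm. *)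

(* Defs.v *)
From HB Require Import structures.
From mathcomp Require Import all_boot all_order all_algebra.
From mathcomp Require Import all_classical all_reals all_analysis.

Set Implicit Arguments.
Unset Strict Implicit.
Unset Printing Implicit Defensive.

Import Order.TTheory GRing.Theory Num.Theory.
Import numFieldNormedType.Exports.

Local Open Scope classical_set_scope.
Local Open Scope ring_scope.

Inductive btree : Type := Leaf | Node of btree & btree.

Fixpoint encode_btree (t : btree) : GenTree.tree unit :=
  match t with
  | Leaf => GenTree.Leaf tt
  | Node u v => GenTree.Node 0 [:: encode_btree u; encode_btree v]
  end.

Fixpoint decode_btree (g : GenTree.tree unit) : option btree :=
  match g with
  | GenTree.Node 0 [:: g1; g2] =>
      if (decode_btree g1, decode_btree g2) is (Some u, Some v)
      then Some (Node u v) else None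
  | GenTree.Leaf _ => Some Leaf
  | _ => None
  end.

Lemma encode_btreeK : pcancel encode_btree decode_btree.
Proof. by elim=> //= u -> v ->. Qed.

HB.instance Definition _ := Countable.copy btree (pcan_type encode_btreeK).

Fixpoint leaves (t : btree) : nat :=
  if t is Node u v then (leaves u + leaves v)%N else 1%N.

Definition trees (n : nat) : set btree := [set t | leaves t = n].

(* [trees n] is finite, so the finitely supported sum over it in
   [avg_dag_size] below is the genuine sum. *)
Lemma finite_trees (n : nat) : finite_set (trees n).
Proof.
have gt0 t : (0 < leaves t)%N by elim: t => //= u Hu v _; rewrite addn_gt0 Hu.
suff : finite_set [set t | (leaves t <= n)%N].
  by apply: sub_finite_set => t /= ->.
elim: n => [|n IHn].
  by apply: (sub_finite_set _ (finite_set0 _)) => t /=; rewrite leqNgt gt0.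
have fin2 := finite_image2 Node IHn IHn.
apply: (@sub_finite_set _ _ ([set Leaf] `|` _) _
          (eq_ind_r id (conj (finite_set1 Leaf) fin2) (finite_setU _ _))).
case=> [|u v] /= H; [by left | right].
exists u; first by rewrite /= -ltnS (leq_trans _ H)// -addn1 leq_add2l.
by exists v => //=; rewrite -ltnS (leq_trans _ H)// -add1n leq_add2r.
Qed.

Fixpoint subtrees (t : btree) : seq btree :=
  t :: (if t is Node u v then subtrees u ++ subtrees v else [::]).

(* Trees are ordered, so isomorphic subtrees are equal terms. *)
Definition dag_size (t : btree) : nat := size (undup (subtrees t)).

(* [sigma] is only constrained, and only ever used, on positive arguments. *)
Definition tree_source (R : realType) (sigma : nat -> nat -> R) : Prop :=
  (forall i j : nat, (0 < i)%N -> (0 < j)%N -> 0 <= sigma i j <= 1) /\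
  (forall k : nat, (2 <= k)%N -> \sum_(1 <= i < k) sigma i (k - i)%N = 1).

Fixpoint tree_prob (R : realType) (sigma : nat -> nat -> R) (t : btree) : R :=
  if t is Node u v
  then sigma (leaves u) (leaves v) * tree_prob sigma u * tree_prob sigma v
  else 1.

Definition avg_dag_size (R : realType) (sigma : nat -> nat -> R) (n : nat) : R :=
  \sum_(t \in trees n) tree_prob sigma t * (dag_size t)%:R.

Definition log2 (R : realType) (x : R) : R := ln x / ln 2.

(* Main.v *)
(* Say that sigma k (n - k) <= rho for n >= N. A tree with n leaves has at least
   n/N - 1 nodes with N or more leaves, so every such tree has probability at
   most rho ^ (n/N - 1). On the other hand, a tree is determined by its DAG, so
   only M ^ O(M) trees have DAG size at most M. For M = c n / log n with c small,
   M ^ O(M) * rho ^ (n/N - 1) <= 1/2, so the DAG size exceeds M with probability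
   at least 1/2. *)
Require Import Defs.
From mathcomp Require Import all_boot all_order all_algebra.
From mathcomp Require Import all_classical all_reals all_analysis.
From mathcomp Require Import ring lra zify.
Import Order.TTheory GRing.Theory Num.Theory.
Import numFieldNormedType.Exports.
Local Open Scope classical_set_scope.
Local Open Scope ring_scope.

(** * Trees with a given number of leaves and their total probability *)

Lemma leaves_gt0 (t : btree) : (0 < leaves t)%N.
Proof. by elim: t => //= u Hu v _; rewrite addn_gt0 Hu. Qed.

Definition tree_seq (n : nat) : seq btree :=
  finmap.enum_fset (fset_set (trees n)).

Lemma mem_tree_seq (n : nat) (t : btree) : (t \in tree_seq n) = (leaves t == n).
Proof.
have := in_fset_set (finite_trees n) t; rewrite /tree_seq => ->.
by apply/idP/eqP; rewrite inE.
Qed.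

Lemma uniq_tree_seq (n : nat) : uniq (tree_seq n).
Proof. exact: finmap.fset_uniq. Qed.

Lemma tree_seq1 : perm_eq (tree_seq 1) [:: Leaf].
Proof.
apply: uniq_perm; rewrite ?uniq_tree_seq// => t.
rewrite mem_tree_seq inE; case: t => //= u v.
have := leaves_gt0 u; have := leaves_gt0 v => u0 v0.
by transitivity false; [apply/negbTE/eqP; lia | apply/esym/negbTE/eqP].
Qed.

(** The leaf count of the left child recovers [i], so no tree is listed twice. *)
Lemma tree_seq_rec (n : nat) : (2 <= n)%N ->
  perm_eq (tree_seq n)
    [seq Node p.1 p.2 | i <- index_iota 1 n,
       p <- [seq (u, v) | u <- tree_seq i, v <- tree_seq (n - i)]].
Proof.
move=> n2; apply: uniq_perm; first exact: uniq_tree_seq.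
  apply: (@allpairs_uniq_dep _ (fun _ => (btree * btree)%type : eqType)).
  - exact: iota_uniq.
  - by move=> i _; apply: allpairs_uniq;
      rewrite ?uniq_tree_seq// => -[? ?] [? ?] _ _.
  - move=> x y /allpairsPdep[i [p [_ /allpairsP[q [qi _ pE]] ->]]].
    move=> /allpairsPdep[j [p' [_ /allpairsP[q' [qj _ pE']] ->]]] /= E.
    have {}E : p = p' by case: E; case: (p) (p') => ? ? [? ?] /= -> ->.
    move: qi qj; rewrite !mem_tree_seq => /eqP <- /eqP <-.
    rewrite -E pE in pE' *; by case: pE' => -> _.
move=> t; rewrite mem_tree_seq; apply/eqP/idP.
  case: t => [|u v] /= E; first by rewrite -E in n2.
  apply/allpairsPdep; exists (leaves u), (u, v); split=> //.
    by rewrite mem_index_iota leaves_gt0 -E -addn1 leq_add2l leaves_gt0.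
  apply/allpairsP; exists (u, v).
  by rewrite !mem_tree_seq -E addKn !eqxx.
move=> /allpairsPdep[i [p [hi /allpairsP[[u v] [/= hu hv ->]] ->]]] /=.
move: hu hv hi; rewrite !mem_tree_seq mem_index_iota => /eqP -> /eqP ->; lia.
Qed.

(** Splitting at the root, the sums over both children are 1 by induction, which leaves the sum of
    [sigma i (n - i)]. *)
Lemma sum_tree_prob (R : realType) (sigma : nat -> nat -> R) (n : nat) :
  tree_source sigma -> (0 < n)%N ->
  \sum_(t <- tree_seq n) tree_prob sigma t = 1.
Proof.
move=> [_ sum1]; elim/ltn_ind: n => n IH n0.
have [n1|n2] := leqP n 1.
  have -> : n = 1%N by lia.
  by rewrite (perm_big _ tree_seq1) big_seq1.
rewrite (perm_big _ (tree_seq_rec n n2)) big_allpairs_dep -[RHS](sum1 n n2).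
rewrite [LHS]big_seq [RHS]big_seq; apply: eq_bigr => i.
rewrite mem_index_iota => /andP[i0 iN].
rewrite big_allpairs_dep /=.
transitivity (\sum_(u <- tree_seq i) sigma i (n - i)%N * tree_prob sigma u).
  rewrite [LHS]big_seq [RHS]big_seq; apply: eq_bigr => u.
  rewrite mem_tree_seq => /eqP ui.
  rewrite -[RHS]mulr1 -(IH (n - i)%N); [|lia..].
  rewrite mulr_sumr [LHS]big_seq [RHS]big_seq; apply: eq_bigr => v.
  by rewrite mem_tree_seq => /eqP <-; rewrite -ui.
by rewrite -mulr_sumr IH// mulr1.
Qed.

Lemma tree_prob_itv (R : realType) (sigma : nat -> nat -> R) (t : btree) :
  tree_source sigma -> 0 <= tree_prob sigma t <= 1.
Proof.
move=> [sigma01 _]; elim: t => /= [|u /andP[u0 u1] v /andP[v0 v1]].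
  by rewrite ler01 lexx.
have /andP[s0 s1] := sigma01 _ _ (leaves_gt0 u) (leaves_gt0 v).
by rewrite !mulr_ge0//= !mulr_ile1// mulr_ge0.
Qed.

(** * Exponential decay of tree probabilities *)

(** A leaf counts 0 even when [N] is 1, since it brings no factor [sigma] to the probability. *)
Fixpoint big_nodes (N : nat) (t : btree) : nat :=
  if t is Node u v
  then ((N <= leaves u + leaves v) + big_nodes N u + big_nodes N v)%N else 0.

(* The nodes with at least [N] leaves form a binary tree with
   [big_nodes N t + 1] hanging subtrees, each having fewer than [N] leaves. *)
Lemma leaves_big_nodes (N : nat) (t : btree) : (0 < N)%N ->
  (leaves t <= (big_nodes N t).+1 * N)%N.
Proof.
move=> N0; elim: t => /= [|u IHu v IHv]; first by rewrite mul1n.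
case: (leqP N) => /= hN; first nia.
by apply: (leq_trans (ltnW hN)); rewrite leq_pmull.
Qed.

(** Each counted node brings a factor at most [rho], every other node one at most 1. *)
Lemma tree_prob_big_nodes (R : realType) (rho : R) (sigma : nat -> nat -> R)
    (N : nat) (t : btree) :
  0 <= rho -> tree_source sigma ->
  (forall i j : nat, (0 < i)%N -> (0 < j)%N -> (N <= i + j)%N ->
     sigma i j <= rho) ->
  tree_prob sigma t <= rho ^+ big_nodes N t.
Proof.
move=> rho0 src bound; elim: t => //= u IHu v IHv.
have /andP[u0 _] := tree_prob_itv R sigma u src.
have /andP[v0 _] := tree_prob_itv R sigma v src.
have /andP[s0 s1] := src.1 _ _ (leaves_gt0 u) (leaves_gt0 v).
rewrite !exprD !ler_pM ?mulr_ge0//.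
case: (boolP (N <= _)%N) => [hN|_]; last by rewrite expr0.
by rewrite expr1 bound ?leaves_gt0.
Qed.

Lemma tree_prob_le (R : realType) (rho : R) (sigma : nat -> nat -> R)
    (N : nat) (t : btree) :
  0 <= rho <= 1 -> tree_source sigma -> (0 < N)%N ->
  (forall i j : nat, (0 < i)%N -> (0 < j)%N -> (N <= i + j)%N ->
     sigma i j <= rho) ->
  tree_prob sigma t <= rho ^+ (leaves t %/ N).-1.
Proof.
move=> /andP[rho0 rho1] src N0 bound.
apply: le_trans (tree_prob_big_nodes R rho sigma N t rho0 src bound) _.
apply: ler_wiXn2l => //; rewrite -subn1 leq_subLR add1n.
by rewrite -(mulnK (big_nodes N t).+1 N0) leq_div2r// leaves_big_nodes.
Qed.

(** * Counting trees through codes of their DAGs *)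

(* [e] maps each inner node of a DAG to its two children; the fuel [k] bounds the
   depth, with [Leaf] as junk value when it runs out. *)
Fixpoint unfold_dag (T : Type) (e : T -> option (T * T)) (k : nat) (x : T) :
    btree :=
  if k is k'.+1 then
    if e x is Some p
    then Node (unfold_dag T e k' p.1) (unfold_dag T e k' p.2) else Leaf
  else Leaf.

(** The fixed table length makes the codes a finite type; past the end of [S] the default [Leaf]
    yields [None]. *)
Definition dag_encode (m : nat) (S : seq btree) :
    {ffun 'I_m.+1 -> option ('I_m.+1 * 'I_m.+1)} :=
  [ffun i : 'I_m.+1 => if nth Leaf S i is Node u v
    then Some (inord (index u S), inord (index v S)) else None].

Lemma subtrees_refl (t : btree) : t \in subtrees t.
Proof. by case: t => *; rewrite inE eqxx. Qed.

(** As [S] contains all subtrees of [t], every child is found at its index, which is below [m.+1].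
    The number of leaves exceeds the depth, so it is enough fuel. *)
Lemma unfold_dag_encode (m : nat) (S : seq btree) (k : nat) (t : btree) :
  (size S <= m.+1)%N -> {subset subtrees t <= S} -> (leaves t <= k)%N ->
  unfold_dag _ (dag_encode m S) k (inord (index t S)) = t.
Proof.
move=> sS; elim: t k => [|u IHu v IHv] k sub kt.
  have LS := sub _ (subtrees_refl Leaf).
  case: k kt => //= k _; rewrite ffunE inordK ?nth_index//.
  by apply: leq_trans sS; rewrite index_mem.
have LS := sub _ (subtrees_refl (Node u v)).
have := leaves_gt0 u; have := leaves_gt0 v.
case: k kt => [|k] /= kt v0 u0; first lia.
rewrite ffunE inordK ?nth_index//=; last first.
  by apply: leq_trans sS; rewrite index_mem.
by rewrite IHu ?IHv//; try (move=> w hw; apply: sub => /=;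
  rewrite inE mem_cat hw ?orbT//); lia.
Qed.

(** Each such tree is decoded from a table and a root index; the bound is the number of these
    pairs. *)
Lemma count_small_dag (n m : nat) :
  (count (fun t => dag_size t <= m.+1)%N (tree_seq n) <=
   m.+1 * (m.+1 ^ 2).+1 ^ m.+1)%N.
Proof.
pose dec (c : {ffun 'I_m.+1 -> option ('I_m.+1 * 'I_m.+1)} * 'I_m.+1) :=
  unfold_dag _ c.1 n c.2.
have -> : (m.+1 * (m.+1 ^ 2).+1 ^ m.+1)%N = size (map dec (enum predT)).
  by rewrite size_map -cardE card_prod card_ffun card_option card_prod card_ord
    -mulnn mulnC.
rewrite -size_filter; apply: uniq_leq_size.
  by rewrite filter_uniq ?uniq_tree_seq.
move=> t; rewrite mem_filter mem_tree_seq => /andP[tm /eqP tn].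
apply/mapP.
exists (dag_encode m (undup (subtrees t)), inord (index t (undup (subtrees t)))).
  by rewrite mem_enum.
rewrite /dec /= unfold_dag_encode ?tn// => u; by rewrite mem_undup.
Qed.

(** * From probabilities to the average *)

Lemma prob_small_dag (R : realType) (rho : R) (sigma : nat -> nat -> R)
    (N n m : nat) :
  0 <= rho <= 1 -> tree_source sigma -> (0 < N)%N ->
  (forall i j : nat, (0 < i)%N -> (0 < j)%N -> (N <= i + j)%N ->
     sigma i j <= rho) ->
  \sum_(t <- tree_seq n | (dag_size t <= m.+1)%N) tree_prob sigma t <=
  (m.+1 * (m.+1 ^ 2).+1 ^ m.+1)%:R * rho ^+ (n %/ N).-1.
Proof.
move=> rho01 src N0 bound; have /andP[rho0 rho1] := rho01.
apply: (@le_trans _ _ (\sum_(t <- tree_seq n | (dag_size t <= m.+1)%N)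
    rho ^+ (n %/ N).-1)).
  rewrite big_seq_cond [leRHS]big_seq_cond; apply: ler_sum => t.
  rewrite mem_tree_seq => /andP[/eqP <- _]; exact: tree_prob_le.
rewrite big_const_seq iter_addr_0 -[leLHS]mulr_natl.
by rewrite ler_wpM2r ?exprn_ge0// ler_nat count_small_dag.
Qed.

(** Markov's inequality: trees of DAG size at most [m] are dropped, the others weigh at least
    [m.+1]. *)
Lemma avg_dag_size_ge (R : realType) (sigma : nat -> nat -> R) (n m : nat) :
  tree_source sigma -> (0 < n)%N ->
  m.+1%:R * (1 - \sum_(t <- tree_seq n | (dag_size t <= m)%N) tree_prob sigma t)
  <= avg_dag_size sigma n.
Proof.
move=> src n0; rewrite /avg_dag_size fsbig_finite/=; last exact: finite_trees.
rewrite -/(tree_seq n) -[X in _ * (X - _)](sum_tree_prob R sigma n src n0).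
rewrite (bigID (fun t => dag_size t <= m)%N)/= addrAC subrr add0r.
rewrite [leRHS](bigID (fun t => dag_size t <= m)%N)/=.
rewrite -[leLHS]add0r lerD//.
  by apply: sumr_ge0 => t _; rewrite mulr_ge0//;
    case/andP: (tree_prob_itv R sigma t src).
rewrite mulr_sumr; apply: ler_sum => t; rewrite -ltnNge => tm.
rewrite mulrC ler_wpM2l ?ler_nat//.
by case/andP: (tree_prob_itv R sigma t src).
Qed.

(** * Asymptotics and choice of constants *)

Lemma ln_nat_small (R : realType) (eps : R) : 0 < eps ->
  \forall n \near \oo, ln (n%:R : R) <= eps * n%:R.
Proof.
move=> eps0; near=> n.
have n0 : 0 < n%:R :> R by rewrite ltr0n; near: n; exact: nbhs_infty_gt.
have s0 : 0 < Num.sqrt (n%:R : R) by rewrite sqrtr_gt0.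
rewrite -{1}[n%:R](sqr_sqrtr (ltW n0)) lnXn//.
(* This is [ln y <= y] at the square root [y] of [n]; it then suffices that [y >= 2 / eps]. *)
apply: le_trans (_ : Num.sqrt n%:R *+ 2 <= _).
  by rewrite lerMn2r/= ltW// ln_sublinear.
rewrite -{2}[n%:R](sqr_sqrtr (ltW n0)) expr2 mulrA -[leLHS]mulr_natl ler_pM2r//.
rewrite -ler_pdivrMl//.
have -> : eps^-1 * 2 = Num.sqrt ((eps^-1 * 2) ^+ 2) :> R.
  by rewrite sqrtr_sqr ger0_norm// mulr_ge0// invr_ge0 ltW.
rewrite ler_sqrt; last exact: ltW.
by near: n; exact: nbhs_infty_ger.
Unshelve. all: by end_near. Qed.

Lemma code_count_le (n M : nat) : (2 <= n)%N -> (0 < M <= n)%N ->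
  (M * (M ^ 2).+1 ^ M <= n ^ (4 * M))%N.
Proof.
move=> n2 /andP[M0 Mn].
have h : ((M ^ 2).+1 ^ M <= n ^ (3 * M))%N.
  (* Here [M ^ 2 + 1 <= n ^ 2 + 1 <= n ^ 3]. *)
  rewrite expnM leq_exp2r// !expnS expn0 !muln1; nia.
apply: leq_trans (leq_mul Mn h) _.
by rewrite -expnS leq_pexp2l//; lia.
Qed.

Theorem theorem3p10 (R : realType) (rho : R) (sigma : nat -> nat -> R)
    (hrho : 0 < rho < 1) (hsigma : tree_source sigma)
    (hbound : \forall n \near \oo, forall k : nat,
       (1 <= k <= n - 1)%N -> sigma k (n - k)%N <= rho) :
  avg_dag_size sigma \is 'Omega_\oo(fun n : nat => n%:R / log2 (n%:R : R)).
Proof.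
have /andP[rho0 rho1] := hrho.
have rho01 : 0 <= rho <= 1 by rewrite !ltW.
have [N N0 bound] : exists2 N : nat, (0 < N)%N &
    forall i j : nat, (0 < i)%N -> (0 < j)%N -> (N <= i + j)%N ->
      sigma i j <= rho.
  case: hbound => N _ hN; exists N.+1 => // i j i0 j0 ij.
  have := hN (i + j)%N (ltnW ij) i; rewrite addKn; apply; lia.
pose L := - ln rho; have L0 : 0 < L by rewrite oppr_gt0 ln_lt0.
have NR0 : 0 < N%:R :> R by rewrite ltr0n.
(* With 8, the exponent [4 * c * n] from counting codes is half of the decay [L * n / N]; the other
   half absorbs lower-order terms. *)
pose c := L / (8 * N%:R).
have c0 : 0 < c by rewrite divr_gt0// mulr_gt0.
have ln20 : 0 < ln 2 :> R by rewrite ln_gt0// ltr1n.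
(* The 2 comes from the probability 1/2, [ln 2] from the binary logarithm. *)
apply/asboolP; exists (c / 2 / ln 2); first exact: divr_gt0 (divr_gt0 c0 _) ln20.
near=> n.
have n2 : (2 <= n)%N by near: n; exact: nbhs_infty_ge.
have nR2 : 2 <= n%:R :> R by rewrite ler_nat.
have nR0 : 0 < n%:R :> R by apply: lt_le_trans nR2.
pose l := ln (n%:R : R).
have l0 : 0 < l by rewrite ln_gt0// ltr1n.
have lsmall : l <= c / 8 * n%:R.
  rewrite /l; near: n; apply: (ln_nat_small R (c / 8)); exact: divr_gt0.
have lbig : 2 * c <= l.
  rewrite /l -[2 * c]expRK ler_ln ?posrE ?expR_gt0//.
  by near: n; exact: nbhs_infty_ger.
have nbig : 2 * L + ln 2 <= c * n%:R.
  by rewrite -ler_pdivrMl//; near: n; exact: nbhs_infty_ger.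
pose x := c * n%:R / l.
have x0 : 0 <= x by rewrite divr_ge0 ?mulr_ge0// ltW.
have xl : x * l = c * n%:R by rewrite /x divfK// gt_eqF.
(* The threshold [m.+1] exceeds [x]; rounding up costs one extra [l], which [lsmall] controls. *)
have := truncn_itv x0; move: (Num.trunc x) => m /andP[mx xm].
have mn : (m.+1 <= n)%N.
  rewrite -(ler_nat R) -natr1.
  (* This is where [lbig] enters. *)
  have : x * 2 <= n%:R by rewrite -(ler_pM2r c0); nra.
  by lra.
have half : \sum_(t <- tree_seq n | (dag_size t <= m.+1)%N) tree_prob sigma t
    <= 2^-1.
  apply: le_trans (prob_small_dag R rho sigma N n m rho01 hsigma N0 bound) _.
  apply: le_trans (_ : (n ^ (4 * m.+1))%:R * rho ^+ (n %/ N).-1 <= _).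
    by rewrite ler_wpM2r ?exprn_ge0 ?(ltW rho0)// ler_nat code_count_le.
  rewrite natrX -ler_ln ?posrE ?invr_gt0 ?mulr_gt0 ?exprn_gt0//.
  rewrite lnM ?posrE ?exprn_gt0// !lnXn// lnV ?posrE// -/l.
  (* One unit is lost to the integer division, one to the predecessor. *)
  have q : (n%:R : R) / N%:R - 2 <= (n %/ N).-1%:R.
    rewrite lerBlDr ler_pdivrMr// -natrD -natrM ler_nat.
    apply: leq_trans (ltnW (ltn_ceil n N0)) _.
    by rewrite leq_mul2r addn2 ltnS leqSpred orbT.
  rewrite -[l *+ _]mulr_natl natrM -[ln rho *+ _]mulr_natl -[ln rho]opprK -/L.
  have cL : c * n%:R * 8 = L * (n%:R / N%:R).
    by rewrite /c; field; rewrite gt_eqF.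
  have := ler_wpM2l (ltW L0) q.
  have : (m.+1%:R : R) * l <= c * n%:R + l.
    by rewrite -natr1 mulrDl mul1r lerD2r -xl ler_pM2r.
  lra.
have E : x / 2 <= avg_dag_size sigma n.
  apply: le_trans (avg_dag_size_ge R sigma n m.+1 hsigma (ltnW n2)).
  rewrite ler_pM ?invr_ge0//; last by lra.
  by apply: le_trans (ltW xm) _; rewrite ler_nat.
rewrite [X in _ <= X]ger0_norm; last by apply: le_trans E; rewrite divr_ge0.
apply: le_trans E; rewrite /log2 -/l ger0_norm; last first.
  by rewrite divr_ge0 ?divr_ge0// ltW.
rewrite le_eqVlt; apply/orP; left; apply/eqP; rewrite /x; field.
by rewrite !gt_eqF.
Unshelve. all: by end_near. Qed.
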